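(* Let the graphs $G_i$, $G=\bigsqcup_iG_i$, the even integer $j$, $\sigma>0$ and $p\ge2$ be as in the context, and let $\alpha$ be a labeling for which property $(\mathrm P_p)$ holds. Let $(Y,d_Y)$ be a complete geodesic $p$-uniformly convex metric space such that $\Lambda^{(p)}_Y(\sigma)<\infty$ or, more generally, $$\lim_{N\to\infty}\Big(\frac{\log\log N}{\log N}\Big)^{\frac1{2p}}\Lambda^{(p)}_Y(\sigma,N)=0.$$ Then every isometric action of $\Gamma_\alpha$ on $Y$ fixes a point.
   Context: $\{G_i\}$: connected non-bipartite finite graphs on $N_i\to\infty$ vertices, degrees in $[3,d]$, spectral gaps $\ge\sigma$, girths $\ge c\log N_i$. $\Gamma$ is free on a symmetric set $S$ of size $2k$, $X=\mathrm{Cay}(\Gamma,S)$, $\mu_X(x\to xs)=\frac1{2k}$, $\mu_X^n$ its convolution powers. A labeling $\alpha$ assigns to each oriented edge of $G$ an element of $S^j$ (word of length $j$) with reverse edges getting inverses; $\Gamma_\alpha$ is the quotient of $\Gamma$ by the normal closure of the products of labels along cycles of $G$. $\Gamma$ acts on $Y$ via $\Gamma\to\Gamma_\alpha$; $B(X,Y)$ = $\Gamma$-equivariant maps $X\to Y$; $\mathcal E^{(p)}_\eta(f)=\frac12\sum_{x'}\eta(x_0\to x')d_Y(f(x_0),f(x'))^p$. $p$-uniformly convex: there is $c_Y>0$ with $d_Y(x,\gamma(t))^p\le(1-t)d_Y(x,y)^p+t\,d_Y(x,z)^p-c_Y^pt(1-t)d_Y(y,z)^p$ for all $x,y,z$,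 constant-speed geodesics $\gamma$ from $y$ to $z$, $t\in[0,1]$. Poincaré modulus $\Lambda^{(p)}_Z(\sigma)$: least $\Lambda$ with $\sum_{u,v}\nu(u)\nu(v)d_Z(f(u),f(v))^p\le\Lambda^p\sum_{u,v}\nu(u)\mu(u\to v)d_Z(f(u),f(v))^p$ for every finite reversible ergodic Markov chain $(V,\mu,\nu)$ of spectral gap $\ge\sigma$ and every $f:V\to Z$; $\Lambda^{(p)}_Y(\sigma,N)=\sup\{\Lambda^{(p)}_{Y'}(\sigma):Y'\subseteq Y,|Y'|\le N\}$. Property $(\mathrm P_p)$ of $\alpha$: there exist constants $a,b,K>0$ such that for every metric space $Y$ and isometric action of $\Gamma_\alpha$ on $Y$ there are arbitrarily large $N_i$ such that for every $f\in B(X,Y)$ there is an integer $m\in[a\log N_i,b\log N_i]$ with $\mathcal E^{(p)}_{\mu_X^{jm}}(f)\le K(\Lambda^{(p)}_Y(\sigma,N_i))^p\mathcal E^{(p)}_{\mu_X^j}(f)$. *)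

(* Defs.v *)
From Stdlib Require Lists.List.
From HB Require Import structures.
From mathcomp Require Import all_boot all_order all_algebra.
From mathcomp Require Import all_classical all_reals all_analysis.
Set Implicit Arguments. Unset Strict Implicit. Unset Printing Implicit Defensive.
Import Order.TTheory GRing.Theory Num.Theory.
Local Open Scope classical_set_scope.
Local Open Scope ring_scope.

Section Defs.
Variable R : realType.

Definition is_metric (Y : Type) (d : Y -> Y -> R) : Prop :=
  (forall x y, d x y = 0 <-> x = y) /\ (forall x y, d x y = d y x) /\
  (forall x y z, d x z <= d x y + d y z).

Definition is_cauchy (Y : Type) (d : Y -> Y -> R) (u : nat -> Y) : Prop :=
  forall eps : R, 0 < eps -> exists N : nat, forall m n : nat,
    (N <= m)%N -> (N <= n)%N -> d (u m) (u n) < eps.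

Definition converges_to (Y : Type) (d : Y -> Y -> R) (u : nat -> Y) (l : Y) : Prop :=
  forall eps : R, 0 < eps -> exists N : nat, forall n : nat, (N <= n)%N -> d (u n) l < eps.

Definition complete_metric (Y : Type) (d : Y -> Y -> R) : Prop :=
  forall u : nat -> Y, is_cauchy d u -> exists l, converges_to d u l.

(* constant-speed geodesic gamma : [0,1] -> Y from y to z (values off [0,1] irrelevant) *)
Definition const_speed_geodesic (Y : Type) (d : Y -> Y -> R) (y z : Y) (g : R -> Y) : Prop :=
  g 0 = y /\ g 1 = z /\
  forall s t : R, 0 <= s <= 1 -> 0 <= t <= 1 -> d (g s) (g t) = `|s - t| * d y z.

Definition geodesic_space (Y : Type) (d : Y -> Y -> R) : Prop :=
  forall y z : Y, exists g : R -> Y, const_speed_geodesic d y z g.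

Definition p_uniformly_convex (Y : Type) (d : Y -> Y -> R) (p : R) : Prop :=
  exists cY : R, 0 < cY /\
  forall (x y z : Y) (g : R -> Y), const_speed_geodesic d y z g ->
  forall t : R, 0 <= t <= 1 ->
    d x (g t) `^ p <= (1 - t) * d x y `^ p + t * d x z `^ p
                      - cY `^ p * t * (1 - t) * d y z `^ p.

Fixpoint kpow (V : finType) (mu : V -> V -> R) (t : nat) : V -> V -> R :=
  match t with
  | 0 => fun u v => (u == v)%:R
  | t'.+1 => fun u v => \sum_(w : V) mu u w * kpow mu t' w v
  end.

(* reversible (w.r.t. the stationary probability nu) and ergodic
   (= irreducible and aperiodic, i.e. some power of mu is entrywise positive) *)
Definition reversible_ergodic_chain (V : finType) (mu : V -> V -> R) (nu : V -> R) : Prop :=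
  (forall u v, 0 <= mu u v) /\ (forall u, \sum_(v : V) mu u v = 1) /\
  (forall u, 0 < nu u) /\ \sum_(u : V) nu u = 1 /\
  (forall u v, nu u * mu u v = nu v * mu v u) /\
  (exists t : nat, forall u v, 0 < kpow mu t u v).

(* spectral gap >= sigma: sigma * Var_nu(f) <= Dirichlet form E(f,f) for all f
   (variational definition of 1 - lambda_2; the factors 1/2 cancel) *)
Definition spectral_gap_ge (V : finType) (mu : V -> V -> R) (nu : V -> R) (sigma : R) : Prop :=
  forall f : V -> R,
    sigma * (\sum_(u : V) \sum_(v : V) nu u * nu v * (f u - f v) ^+ 2)
    <= \sum_(u : V) \sum_(v : V) nu u * mu u v * (f u - f v) ^+ 2.

Definition poincare_ineq (p sigma : R) (Z : Type) (dZ : Z -> Z -> R) (L : R) : Prop :=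
  forall (V : finType) (mu : V -> V -> R) (nu : V -> R),
    reversible_ergodic_chain mu nu -> spectral_gap_ge mu nu sigma ->
    forall f : V -> Z,
      \sum_(u : V) \sum_(v : V) nu u * nu v * dZ (f u) (f v) `^ p
      <= L `^ p * \sum_(u : V) \sum_(v : V) nu u * mu u v * dZ (f u) (f v) `^ p.

(* Lambda^{(p)}_Z(sigma) in [0, +oo] (+oo if no finite Lambda works) *)
Definition poincare_modulus (p sigma : R) (Z : Type) (dZ : Z -> Z -> R) : \bar R :=
  ereal_inf [set L%:E | L in [set L : R | 0 <= L /\ poincare_ineq p sigma dZ L]].

Definition subset_card_le (Y : Type) (N : nat) (A : set Y) : Prop :=
  exists s : seq Y, (size s <= N)%N /\ forall y, A y -> Stdlib.Lists.List.In y s.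

Definition poincare_modulus_N (p sigma : R) (Y : Type) (d : Y -> Y -> R) (N : nat) : \bar R :=
  ereal_sup [set poincare_modulus p sigma (fun a b : {y : Y | A y} => d (sval a) (sval b))
            | A in [set A : set Y | subset_card_le N A]].

End Defs.

(* (i, false) = a_i, (i, true) = a_i^{-1};  |S| = 2k *)
Definition gen (k : nat) : finType := ('I_k * bool)%type.
Definition ginv (k : nat) (s : gen k) : gen k := (s.1, ~~ s.2).
Definition word_inv (k : nat) (w : seq (gen k)) : seq (gen k) := rev (map (@ginv k) w).

Definition act_word (Y : Type) (k : nat) (rho : gen k -> Y -> Y) (w : seq (gen k)) (y : Y) : Y :=
  foldr rho y w.

(* isometric action of the free group Gamma, given by the images of the generators *)
Definition isometric_free_action (R : realType) (Y : Type) (d : Y -> Y -> R) (k : nat)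
  (rho : gen k -> Y -> Y) : Prop :=
  (forall s x y, d (rho s x) (rho s y) = d x y) /\ (forall s y, rho (ginv s) (rho s y) = y).

Definition is_cycle (T : finType) (e : rel T) (c : seq T) : Prop :=
  (3 <= size c)%N /\ uniq c /\ cycle e c.

Definition is_labeling (T : nat -> finType) (e : forall i, rel (T i)) (k j : nat)
  (alpha : forall i, T i -> T i -> j.-tuple (gen k)) : Prop :=
  forall i u v, e i u v -> (alpha i v u : seq (gen k)) = word_inv (alpha i u v).

Definition cycle_word (T : finType) (k j : nat) (a : T -> T -> j.-tuple (gen k)) (c : seq T)
  : seq (gen k) :=
  flatten [seq (a x.1 x.2 : seq (gen k)) | x <- zip c (rot 1 c)].

(* isometric action of Gamma_alpha = Gamma / <<cycle relators>> *)
Definition alpha_action (R : realType) (Y : Type) (d : Y -> Y -> R)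
  (T : nat -> finType) (e : forall i, rel (T i)) (k j : nat)
  (alpha : forall i, T i -> T i -> j.-tuple (gen k)) (rho : gen k -> Y -> Y) : Prop :=
  isometric_free_action d rho /\
  forall i (c : seq (T i)), is_cycle (e i) c ->
    forall y, act_word rho (cycle_word (alpha i) c) y = y.

(* E^{(p)}_{mu_X^n}(f) for the equivariant f in B(X,Y) with f(x0) = y, x0 = identity:
   1/2 sum_{x'} mu_X^n(x0 -> x') d(f x0, f x')^p, expanding mu_X^n over the (2k)^n words *)
Definition energy (R : realType) (p : R) (Y : Type) (d : Y -> Y -> R) (k : nat)
  (rho : gen k -> Y -> Y) (n : nat) (y : Y) : R :=
  2^-1 * \sum_(w : n.-tuple (gen k)) ((2 * k)%:R ^- n) * d y (act_word rho w y) `^ p.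

Definition property_P (R : realType) (p sigma : R)
  (T : nat -> finType) (e : forall i, rel (T i)) (k j : nat)
  (alpha : forall i, T i -> T i -> j.-tuple (gen k)) : Prop :=
  exists a b K : R, 0 < a /\ 0 < b /\ 0 < K /\
  forall (Y : Type) (d : Y -> Y -> R), is_metric d ->
  forall rho : gen k -> Y -> Y, alpha_action d e alpha rho ->
  forall M : nat, exists i : nat, (M <= #|T i|)%N /\
    forall y : Y, exists m : nat,
      a * ln (#|T i|%:R) <= m%:R <= b * ln (#|T i|%:R) /\
      ((energy p d rho (j * m) y)%:E
        <= K%:E * (poweR (poincare_modulus_N p sigma d #|T i|) p) * (energy p d rho j y)%:E)%E.

Definition deg (T : finType) (e : rel T) (u : T) : nat := #|[set v | e u v]|.

Definition srw_mu (R : realType) (T : finType) (e : rel T) (u v : T) : R :=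
  (e u v)%:R / (deg e u)%:R.
Definition srw_nu (R : realType) (T : finType) (e : rel T) (u : T) : R :=
  (deg e u)%:R / (\sum_(w : T) deg e w)%:R.

Definition graph_family (R : realType) (T : nat -> finType) (e : forall i, rel (T i))
  (dg : nat) (cg sigma : R) : Prop :=
  (forall i, symmetric (e i) /\ irreflexive (e i)) /\
  (forall i (u v : T i), connect (e i) u v) /\
  (forall i, ~ exists col : T i -> bool, forall u v, e i u v -> col u != col v) /\
  (forall M : nat, exists i0, forall i, (i0 <= i)%N -> (M <= #|T i|)%N) /\
  (forall i (u : T i), (3 <= deg (e i) u <= dg)%N) /\
  (forall i, spectral_gap_ge (@srw_mu R _ (e i)) (@srw_nu R _ (e i)) sigma) /\
  (forall i (c : seq (T i)), is_cycle (e i) c -> cg * ln (#|T i|%:R) <= (size c)%:R).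

(* Main.v *)
(** The [j]-letter words act as a random walk by isometries, and the energy of an orbit map is
    half of a moment [E d(y, W y)^p] of this walk. Let [z] be an approximate [p]-barycenter of
    the law of [W y] after [m] steps. Averaging the uniform convexity inequality of the moment
    at [z] over the translates of [z] bounds the energy of [z] by the growth of this moment
    from time [m] to time [m + 1]. Since [j] is even, the walk is lazy, so its powers are
    binomial mixtures of the powers of a second walk, and the Chernoff bound shows that one
    more step increases a moment at most by the factor [1 + O(sqrt (ln m / m))], up to
    negligible tails. With property [(P_p)] the energy of [z] is at most
    [O(sqrt (ln ln N / ln N) (1 + Lambda^p))] times that of [y], so for one fixed large [N] it
    is contracted, and [d(y, z)^p] is at most a constant times the energy of [y]. Iterating
    yields a point fixed by all words of length [j], hence by all products of two generators;
    all generators exchange it with one and the same point, and fix the midpoint. *)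

Require Import Defs.
From HB Require Import structures.
From mathcomp Require Import all_boot all_order all_algebra.
From mathcomp Require Import all_classical all_reals all_analysis.
From mathcomp Require Import unstable ring lra.
Set Implicit Arguments. Unset Strict Implicit. Unset Printing Implicit Defensive.
Import Order.TTheory GRing.Theory Num.Theory.
Import numFieldNormedType.Exports.
Local Open Scope classical_set_scope.
Local Open Scope ring_scope.

Section RealPowers.
Context {R : realType}.
Implicit Types p x y : R.

Lemma ler_wpowR2r p x y : 0 <= p -> 0 <= x -> x <= y -> x `^ p <= y `^ p.
Proof.
by move=> p_ge0 x_ge0 le_xy; rewrite ge0_ler_powR // nnegrE (le_trans x_ge0).
Qed.

Lemma powRK p x : p != 0 -> 0 <= x -> (x `^ p) `^ p^-1 = x.
Proof. by move=> p_neq0 x_ge0; rewrite -powRrM mulfV // powRr1. Qed.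

Lemma powRVK p x : p != 0 -> 0 <= x -> (x `^ p^-1) `^ p = x.
Proof. by move=> p_neq0; rewrite -{2}[p]invrK; apply: powRK; rewrite invr_neq0. Qed.

Lemma ler_powR_root p x y : 0 < p -> 0 <= x -> x `^ p <= y -> x <= y `^ p^-1.
Proof.
move=> p_gt0 x_ge0 le_y; rewrite -(powRK (lt0r_neq0 p_gt0) x_ge0).
by rewrite ler_wpowR2r ?powR_ge0 // invr_ge0 ltW.
Qed.

Lemma powRD_le p x y : 0 <= p -> 0 <= x -> 0 <= y ->
  (x + y) `^ p <= 2 `^ p * (x `^ p + y `^ p).
Proof.
move=> p_ge0; wlog le_xy : x y / x <= y => [wlog_le x_ge0 y_ge0|x_ge0 y_ge0].
  have [/wlog_le->//|/ltW le_yx] := leP x y.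
  by rewrite addrC [x `^ p + _]addrC wlog_le.
apply: (@le_trans _ _ ((2 * y) `^ p)); first by rewrite ler_wpowR2r //; lra.
by rewrite powRM // ler_wpM2l ?powR_ge0 // lerDr powR_ge0.
Qed.

Lemma powR_affine_le p x y n : 0 <= p -> 0 <= x -> 0 <= y -> 1 <= n ->
  (x + n * y) `^ p <= n `^ p * (2 `^ p * (x `^ p + y `^ p)).
Proof.
move=> p_ge0 x_ge0 y_ge0 n_ge1; have n_ge0 : 0 <= n by lra.
apply: (@le_trans _ _ ((n * (x + y)) `^ p)).
  rewrite ler_wpowR2r ?addr_ge0 ?mulr_ge0 // mulrDr lerD2r.
  by rewrite ler_peMl.
by rewrite powRM ?addr_ge0 // ler_wpM2l ?powR_ge0 // powRD_le.
Qed.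

Lemma powR_expR_le_inv p x u : 0 < x -> (p + 1) * ln x <= u ->
  x `^ p * expR (- u) <= x^-1.
Proof.
move=> x_gt0 le_u; rewrite /powR gt_eqF // -expRD -[leRHS]lnK ?posrE ?invr_gt0 //.
by rewrite ler_expR lnV ?posrE //; lra.
Qed.

Lemma expR_le_quadratic x : x <= 2^-1 -> expR x <= 1 + x + 2 * x ^+ 2.
Proof.
move=> x_le; have x1_gt0 : 0 < 1 - x by lra.
have mul_expR_le1 : (1 - x) * expR x <= 1.
  by rewrite -ler_pdivlMr ?expR_gt0 // mul1r -expRN expR_ge1Dx.
rewrite -(ler_pM2l x1_gt0) (le_trans mul_expR_le1) //.
have -> : (1 - x) * (1 + x + 2 * x ^+ 2) = 1 + x ^+ 2 * (1 - 2 * x) by ring.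
by rewrite lerDl mulr_ge0 ?sqr_ge0 //; lra.
Qed.

End RealPowers.

Section LogarithmAsymptotics.
Context {R : realType}.

Lemma cvgr_ln : (ln x : R) @[x --> +oo] --> +oo.
Proof.
by apply/cvgryPge => A; near=> x; rewrite -[A]expRK ler_ln ?posrE ?expR_gt0.
Unshelve. all: by end_near. Qed.

Lemma ln_div_cvg0 : (ln x / x : R) @[x --> +oo] --> (0 : R).
Proof.
apply/cvgr0Pnorm_le => eps eps_gt0; near=> x.
have x_ge1 : 1 <= x by [].
have le_x : 4 / eps ^+ 2 <= x by [].
have x_gt0 : 0 < x by lra.
have xE : x = Num.sqrt x ^+ 2 by rewrite sqr_sqrtr // ltW.
have sqrt_gt0 : 0 < Num.sqrt x by rewrite sqrtr_gt0.
have ln_le : ln x <= 2 * Num.sqrt x.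
  by rewrite {1}xE lnXn // -[_ *+ 2]mulr_natl ler_pM2l // ltW // ln_sublinear.
have sqrt_ge : 2 <= eps * Num.sqrt x.
  rewrite -(ler_pXn2r (ltn0Sn 1)) ?nnegrE ?mulr_ge0 ?(ltW eps_gt0) ?(ltW sqrt_gt0) //.
  by rewrite exprMn -xE; move: le_x; rewrite ler_pdivrMr ?exprn_gt0 //; lra.
rewrite ger0_norm ?divr_ge0 ?ln_ge0 ?(ltW x_gt0) // ler_pdivrMr //.
apply: (le_trans ln_le); rewrite {2}xE expr2 mulrA.
by rewrite ler_wpM2r // ltW.
Unshelve. all: by end_near. Qed.

Definition loglog_ratio (N : nat) : R := ln (ln N%:R) / ln N%:R.

Lemma near_ln_nat_ge (A : R) : \forall N \near \oo, A <= ln N%:R.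
Proof. by have := cvg_comp _ _ (@cvgr_idn R) cvgr_ln; move=> /cvgryPge. Qed.

Lemma loglog_ratio_gt0 : \forall N \near \oo, 0 < loglog_ratio N.
Proof.
near=> N; have ln_gt1 : 1 < ln (N%:R : R).
  by rewrite (@lt_le_trans _ _ 2) ?ltr1n //; near: N; exact: near_ln_nat_ge.
by apply: divr_gt0; [exact: ln_gt0 | exact: lt_trans ln_gt1].
Unshelve. all: by end_near. Qed.

Lemma loglog_ratio_cvg_at_right : loglog_ratio N @[N --> \oo] --> (0 : R)^'+.
Proof.
have ratio_cvg0 : loglog_ratio N @[N --> \oo] --> (0 : R).
  exact: cvg_comp (cvg_comp _ _ (@cvgr_idn R) cvgr_ln) ln_div_cvg0.
move=> A /ratio_cvg0; apply: filterS2 loglog_ratio_gt0 => N ratio_gt0.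
exact.
Qed.

Lemma loglog_ratio_powR_cvg0 (a : R) : 0 < a ->
  loglog_ratio N `^ a @[N --> \oo] --> (0 : R).
Proof. by move=> /powR_cvg0; apply: cvg_comp loglog_ratio_cvg_at_right. Qed.

End LogarithmAsymptotics.

Section BinomialTails.
Context {R : realType}.
Variable q : R.
Hypothesis q01 : 0 <= q <= 1.

Lemma binomial_pmfE (n i : nat) :
  binomial_pmf n q i = q ^+ i * q.~ ^+ (n - i) * 'C(n, i)%:R.
Proof. by rewrite mulr_natr. Qed.

Lemma bernoulli_mgf_le (t : R) : 0 <= t <= 2^-1 ->
  q.~ * expR (- (t * q)) + q * expR (t * q.~) <= expR (t ^+ 2).
Proof.
move: q01 => /andP[q_ge0 q_le1] /andP[t_ge0 t_le].
have q1_ge0 : 0 <= q.~ by rewrite onem_ge0.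
apply: (@le_trans _ _ (1 + t ^+ 2)); last exact: expR_ge1Dx.
have le_failure : expR (- (t * q)) <= 1 + - (t * q) + 2 * (- (t * q)) ^+ 2.
  by apply: expR_le_quadratic; nra.
have le_success : expR (t * q.~) <= 1 + (t * q.~) + 2 * (t * q.~) ^+ 2.
  by apply: expR_le_quadratic; rewrite /onem; nra.
apply: (le_trans (lerD (ler_wpM2l q1_ge0 le_failure) (ler_wpM2l q_ge0 le_success))).
have -> : q.~ * (1 + - (t * q) + 2 * (- (t * q)) ^+ 2)
   + q * (1 + t * q.~ + 2 * (t * q.~) ^+ 2) = 1 + t ^+ 2 * (2 * (q * q.~)).
  by rewrite /onem; ring.
by rewrite lerD2l ler_piMr ?sqr_ge0 // /onem; nra.
Qed.

Lemma binomial_mgf_le (n : nat) (t : R) : 0 <= t <= 2^-1 ->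
  \sum_(i < n.+1) binomial_pmf n q i * expR (t * (i%:R - n%:R * q))
    <= expR (n%:R * t ^+ 2).
Proof.
move=> t01; have [q_ge0 q_le1] := andP q01.
have -> : \sum_(i < n.+1) binomial_pmf n q i * expR (t * (i%:R - n%:R * q))
    = (q.~ * expR (- (t * q)) + q * expR (t * q.~)) ^+ n.
  rewrite exprDn; apply: eq_bigr => i _.
  rewrite binomial_pmfE -[RHS]mulr_natr !exprMn.
  have -> : expR (t * (i%:R - n%:R * q))
      = expR (- (t * q)) ^+ (n - i) * expR (t * q.~) ^+ i.
    rewrite -!expRM_natl -expRD natrB; last by rewrite -ltnS.
    by congr expR; rewrite /onem; ring.
  by ring.
rewrite expRM_natl lerXn2r ?nnegrE ?expR_ge0 ?bernoulli_mgf_le //.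
by rewrite addr_ge0 ?mulr_ge0 ?expR_ge0 ?onem_ge0.
Qed.

(* Markov's inequality for the exponential moment of parameter s / 2. *)
Lemma binomial_upper_tail (n : nat) (s : R) : 0 <= s <= 1 ->
  \sum_(i < n.+1 | n%:R * (q + s) <= i%:R) binomial_pmf n q i
    <= expR (- (n%:R * (s / 2) ^+ 2)).
Proof.
move=> /andP[s_ge0 s_le1]; have s2_ge0 : 0 <= s / 2 by rewrite divr_ge0.
have -> : expR (- (n%:R * (s / 2) ^+ 2))
    = expR (n%:R * (s / 2) ^+ 2) * expR (- (s / 2 * (n%:R * s))).
  by rewrite -expRD; congr expR; field.
have := @binomial_mgf_le n (s / 2); rewrite s2_ge0 ler_piMl ?invr_ge0 // => /(_ isT).
rewrite -(ler_pM2r (expR_gt0 (- (s / 2 * (n%:R * s))))); apply: le_trans.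
rewrite mulr_suml big_mkcond ler_sum // => i _.
have pmf_ge0 : 0 <= binomial_pmf n q i by rewrite binomial_pmf_ge0.
case: ifP => [tail_i|_]; last by rewrite !mulr_ge0 ?expR_ge0.
rewrite -[leRHS]mulrA -expRD ler_peMr // -[leLHS]expR0 ler_expR.
have -> : s / 2 * (i%:R - n%:R * q) - s / 2 * (n%:R * s)
    = s / 2 * (i%:R - n%:R * (q + s)) by ring.
by rewrite mulr_ge0 ?subr_ge0.
Qed.

Lemma binomial_pmf_trialS (m i : nat) : (i <= m)%N ->
  (m.+1 - i)%:R * binomial_pmf m.+1 q i = m.+1%:R * q.~ * binomial_pmf m q i.
Proof.
move=> le_im; rewrite !binomial_pmfE subSn // exprS -subSn //.
have bin_down : m.+1%:R * 'C(m, i)%:R = (m.+1 - i)%:R * 'C(m.+1, i)%:R :> R.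
  by rewrite -!natrM -mul_bin_down.
rewrite [RHS](_ : _ = q ^+ i * (q.~ * q.~ ^+ (m - i)) * (m.+1%:R * 'C(m, i)%:R)).
  by rewrite bin_down; ring.
by ring.
Qed.

Lemma binomial_pmf_trialS_le (eps : R) (m i : nat) : 0 <= eps <= 1 ->
  i%:R < m.+1%:R * (q + q.~ * eps / 2) ->
  binomial_pmf m.+1 q i <= (1 + eps) * binomial_pmf m q i.
Proof.
move=> /andP[eps_ge0 eps_le1]; have [q_ge0 q_le1] := andP q01.
set n : R := m.+1%:R => bulk_i; have n_gt0 : 0 < n by rewrite ltr0n.
have nq1_ge0 : 0 <= n * q.~ by rewrite mulr_ge0 ?onem_ge0 // ltW.
have lt_in : i%:R < n.
  by apply: (lt_le_trans bulk_i); rewrite ler_piMr ?(ltW n_gt0) // /onem; nra.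
have le_im : (i <= m)%N by rewrite -ltnS -(ltr_nat R).
have ni_gt0 : 0 < (m.+1 - i)%:R :> R by rewrite ltr0n subn_gt0 ltnS.
rewrite -(ler_pM2l ni_gt0) binomial_pmf_trialS // mulrA.
rewrite ler_wpM2r ?binomial_pmf_ge0 // natrB; last by rewrite leqW.
have le_ni : (1 - eps / 2) * (n * q.~) <= n - i%:R.
  by move: bulk_i; rewrite /onem; lra.
apply: (@le_trans _ _ ((1 - eps / 2) * (n * q.~) * (1 + eps))).
  by rewrite mulrAC ler_peMl //; nra.
by rewrite ler_wpM2r // addr_ge0.
Qed.

(* Adding a trial multiplies the weights by at most 1 + eps, except in the upper tail. *)
Lemma binomial_mean_trialS (eps B : R) (m : nat) (a : nat -> R) : 0 <= eps <= 1 ->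
  (forall i, (i <= m.+1)%N -> 0 <= a i <= B) ->
  \sum_(i < m.+2) binomial_pmf m.+1 q i * a i <=
  (1 + eps) * (\sum_(i < m.+1) binomial_pmf m q i * a i)
    + B * expR (- (m.+1%:R * (q.~ * eps / 4) ^+ 2)).
Proof.
move=> eps01 a_bounds; have [eps_ge0 eps_le1] := andP eps01; have [q_ge0 q_le1] := andP q01.
have pmf_ge0 n i : 0 <= binomial_pmf n q i by rewrite binomial_pmf_ge0.
pose s := q.~ * eps / 2; have -> : q.~ * eps / 4 = s / 2 by rewrite /s; field.
have s01 : 0 <= s <= 1 by rewrite /s /onem; apply/andP; split; nra.
have B_ge0 : 0 <= B by have /andP[] := a_bounds 0%N isT; apply: le_trans.
have -> : (1 + eps) * (\sum_(i < m.+1) binomial_pmf m q i * a i) =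
    \sum_(i < m.+2) (1 + eps) * (binomial_pmf m q i * a i).
  rewrite [RHS]big_ord_recr /= [X in _ + _ * (X * _)]binomial_pmfE bin_small //.
  by rewrite mulr0 mul0r mulr0 addr0 mulr_sumr.
apply: (le_trans _ (lerD (lexx _) (ler_wpM2l B_ge0 (binomial_upper_tail m.+1 s01)))).
rewrite mulr_sumr [X in _ <= _ + X]big_mkcond -big_split ler_sum //= => i _.
have /andP[a_ge0 a_le] : 0 <= a i <= B by apply: a_bounds; rewrite -ltnS.
have [_|bulk_i] := leP (m.+1%:R * (q + s)) i%:R.
  apply: (@le_trans _ _ (B * binomial_pmf m.+1 q i)); first by rewrite mulrC ler_wpM2r.
  by rewrite lerDr !mulr_ge0 // addr_ge0.
by rewrite addr0 mulrA ler_wpM2r // binomial_pmf_trialS_le.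
Qed.

End BinomialTails.

Section LogarithmicTime.
Context {R : realType}.
Implicit Types p a b t n : R.

Lemma sqrt_ln_div_ge_inv t : 0 < t -> 1 <= ln t -> t^-1 <= Num.sqrt (ln t / t).
Proof.
move=> t_gt0 lnt_ge1; have lnt_lt := ln_sublinear t_gt0.
have tV_ge0 : 0 <= t^-1 by rewrite invr_ge0 ltW.
rewrite -[leLHS]ger0_norm // -sqrtr_sqr ler_wsqrtr // expr2 ler_wpM2r //.
by rewrite (le_trans _ lnt_ge1) // invf_le1 //; lra.
Qed.

(* The condition on eps under which the Chernoff bound absorbs the growth of p-th moments over
   n steps of a walk holding with probability al. *)
Definition negligible_tail p (al eps : R) n : bool :=
  n `^ p * expR (- (n * (al * eps / 4) ^+ 2)) <= eps.

(* For n between a t and t ^ 2 the exponent is at least (p + 1) ln n. *)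
Lemma powR_expR_sqrt_ln_le p a (al A : R) t n : 0 < p -> 0 < a -> a^-1 <= A ->
  32 * (p + 1) <= a * (al * A) ^+ 2 -> 0 < t -> 1 <= ln t -> a * t <= n <= t ^+ 2 ->
  negligible_tail p al (A * Num.sqrt (ln t / t)) n.
Proof.
move=> p_gt0 a_gt0 A_ge alA_ge t_gt0 lnt_ge1 /andP[n_ge n_le].
have lnt_ge0 : 0 <= ln t by lra.
have at_gt0 : 0 < a * t by rewrite mulr_gt0.
have n_gt0 : 0 < n by lra.
have inv_le : n^-1 <= A * Num.sqrt (ln t / t).
  apply: (@le_trans _ _ (a * t)^-1); first by rewrite lef_pV2 ?posrE.
  by rewrite invfM ler_pM ?invr_ge0 ?sqrt_ln_div_ge_inv // ltW.
apply: le_trans inv_le; apply: powR_expR_le_inv => //.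
rewrite mulrA [_ / 4]mulrAC exprMn sqr_sqrtr ?divr_ge0 ?(ltW t_gt0) //.
have ln_n : (p + 1) * ln n <= 2 * (p + 1) * ln t.
  rewrite -mulrA mulrCA ler_wpM2l //; first by lra.
  by rewrite mulr_natl -lnXn // ler_ln ?posrE ?exprn_gt0.
apply: (le_trans ln_n); apply: (@le_trans _ _ ((al * A / 4) ^+ 2 * (a * ln t))).
  rewrite mulrA ler_wpM2r // exprMn exprVn; lra.
have n_ratio : a * ln t <= n * (ln t / t).
  by rewrite mulrA ler_pdivlMr // mulrAC ler_wpM2r.
by rewrite [leRHS]mulrCA ler_wpM2l ?sqr_ge0.
Qed.

Lemma near_negligible_tail p a b (al : R) : 0 < p -> 0 < a -> 0 < b -> 0 < al ->
  exists2 A : R, 0 < A & \forall N \near \oo, forall m : nat,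
    a * ln N%:R <= m%:R <= b * ln N%:R ->
    negligible_tail p al (A * Num.sqrt (loglog_ratio N)) m.+1%:R.
Proof.
move=> p_gt0 a_gt0 b_gt0 al_gt0; have e_gt0 := expR_gt0 (1 : R).
pose c := 32 * (p + 1) / (a * al ^+ 2).
have aal_gt0 : 0 < a * al ^+ 2 by rewrite mulr_gt0 // exprn_gt0.
have c_gt0 : 0 < c by rewrite divr_gt0 // mulr_gt0 //; lra.
have aV_gt0 : 0 < a^-1 by rewrite invr_gt0.
pose A := 1 + a^-1 + c; have A_ge1 : 1 <= A by rewrite /A; lra.
have alA_ge : 32 * (p + 1) <= a * (al * A) ^+ 2.
  rewrite exprMn mulrA [leRHS]mulrC -ler_pdivrMr // -/c (@le_trans _ _ A) //.
    by rewrite /A; lra.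
  by rewrite expr2 ler_peMl //; lra.
exists A; first by lra.
near=> N; have : expR 1 + b + 1 <= ln (N%:R : R) by near: N; exact: near_ln_nat_ge.
rewrite /loglog_ratio; set t : R := ln N%:R => t_ge m /andP[m_ge m_le].
have lnt_ge1 : 1 <= ln t by rewrite -(expRK (1 : R)) ler_ln ?posrE //; lra.
have t2_ge : (b + 1) * t <= t ^+ 2 by rewrite expr2 ler_pM2r //; lra.
by apply: (powR_expR_sqrt_ln_le p_gt0 a_gt0 _ alA_ge _ lnt_ge1); rewrite -?natr1 /A; lra.
Unshelve. all: by end_near. Qed.

End LogarithmicTime.

Definition avg (R : realType) (Y : Type) (I : finType) (mu : I -> R) (g : I -> Y -> Y)
  (h : Y -> R) (y : Y) : R := \sum_(i : I) mu i * h (g i y).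

Section AverageOperators.
Variables (R : realType) (Y : Type) (I : finType) (mu : I -> R) (g : I -> Y -> Y).
Local Notation A := (avg mu g).

Lemma iter_avgD (n : nat) (a b : R) (h1 h2 : Y -> R) (y : Y) :
  iter n A (fun v => a * h1 v + b * h2 v) y = a * iter n A h1 y + b * iter n A h2 y.
Proof.
elim: n y => [//|n IHn] y; rewrite !iterS /avg !mulr_sumr -big_split /=.
by apply: eq_bigr => i _; rewrite IHn; ring.
Qed.

Lemma iter_avg_sum (n : nat) (J : finType) (b : J -> R) (h : J -> Y -> R) (y : Y) :
  iter n A (fun v => \sum_(l : J) b l * h l v) y = \sum_(l : J) b l * iter n A (h l) y.
Proof.
elim: n y => [//|n IHn] y; rewrite iterS /avg.
under [LHS]eq_bigr do rewrite IHn mulr_sumr.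
rewrite exchange_big /=; apply: eq_bigr => l _; rewrite mulr_sumr.
by apply: eq_bigr => i _; rewrite mulrCA.
Qed.

Lemma iter_avg_lazy (q : R) (n : nat) (h : Y -> R) (y : Y) :
  iter n (fun h' v => q.~ * h' v + q * A h' v) h y =
  \sum_(i < n.+1) binomial_pmf n q i * iter i A h y.
Proof.
elim: n h => [|n IHn] h.
  by rewrite big_ord1 /binomial_pmf bin0 !expr0 !mul1r.
rewrite iterSr IHn.
under eq_bigr do rewrite iter_avgD -iterSr mulrDr binomial_pmfE.
rewrite big_split /= [RHS]big_ord_recl binomial_pmfE bin0 subn0.
under [in RHS]eq_bigr do rewrite lift0 binomial_pmfE binS natrD subSS mulrDr mulrDl.
rewrite big_split /= addrA; congr (_ + _); last first.
  by apply: eq_bigr => i _; rewrite exprS; ring.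
rewrite [in RHS]big_ord_recr /= bin_small // mulr0 mul0r addr0.
rewrite big_ord_recl bin0 subn0; congr (_ + _); first by rewrite /= exprS; ring.
apply: eq_bigr => i _; rewrite lift0 -[in RHS](subnSK (ltn_ord i)).
by rewrite !exprS /=; ring.
Qed.

Section Monotonicity.
Hypothesis mu_ge0 : forall i, 0 <= mu i.

Lemma le_iter_avg (n : nat) (h1 h2 : Y -> R) (y : Y) :
  (forall v, h1 v <= h2 v) -> iter n A h1 y <= iter n A h2 y.
Proof.
move=> le_h; elim: n y => [//|n IHn] y; rewrite !iterS /avg.
by apply: ler_sum => i _; rewrite ler_wpM2l.
Qed.

Lemma iter_avg_ge0 (n : nat) (h : Y -> R) (y : Y) :
  (forall v, 0 <= h v) -> 0 <= iter n A h y.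
Proof.
move=> h_ge0; elim: n y => [//|n IHn] y.
by rewrite iterS sumr_ge0 // => i _; rewrite mulr_ge0.
Qed.

End Monotonicity.

Lemma iter_avg_cst (n : nat) (x : R) (y : Y) : \sum_i mu i = 1 -> iter n A (fun=> x) y = x.
Proof.
move=> mu_sum1; elim: n y => [//|n IHn] y.
by rewrite iterS /avg; under eq_bigr do rewrite IHn; rewrite -mulr_suml mu_sum1 mul1r.
Qed.

End AverageOperators.

Section ConditionalWeights.
Variables (R : realType) (I : finType) (mu : I -> R) (i0 : I).
Hypotheses (mu_ge0 : forall i, 0 <= mu i) (mu_sum1 : \sum_i mu i = 1) (mu_lt1 : mu i0 < 1).

Definition weight_avoiding (i : I) : R := if i == i0 then 0 else mu i / (mu i0).~.

Lemma weight_avoiding_ge0 (i : I) : 0 <= weight_avoiding i.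
Proof.
by rewrite /weight_avoiding; case: ifP => // _; rewrite divr_ge0 // onem_ge0 // ltW.
Qed.

Lemma avg_lazyE (Y : Type) (g : I -> Y -> Y) (h : Y -> R) (y : Y) : g i0 y = y ->
  avg mu g h y = mu i0 * h y + (mu i0).~ * avg weight_avoiding g h y.
Proof.
move=> gy; rewrite /avg (bigD1 i0) //= gy; congr (_ + _).
rewrite [X in _ = _ * X](bigD1 i0) //= /weight_avoiding eqxx mul0r add0r mulr_sumr.
apply: eq_bigr => i /negbTE ->; rewrite mulrA mulrCA divff ?mulr1 //.
by rewrite gt_eqF // onem_gt0.
Qed.

Lemma sum_weight_avoiding : \sum_i weight_avoiding i = 1.
Proof.
have onem_neq0 : (mu i0).~ != 0 by rewrite gt_eqF // onem_gt0.
have := @avg_lazyE unit (fun=> id) (fun=> 1) tt erefl.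
rewrite /avg -!mulr_suml mu_sum1 !mulr1 => mass_split.
by apply: (mulfI onem_neq0); move: mass_split; rewrite /onem; lra.
Qed.

End ConditionalWeights.

Lemma metric_xx (R : realType) (Y : Type) (d : Y -> Y -> R) (x : Y) :
  is_metric d -> d x x = 0.
Proof. by move=> [d_eq0 _]; apply/d_eq0. Qed.

Lemma metric_ge0 (R : realType) (Y : Type) (d : Y -> Y -> R) (x y : Y) :
  is_metric d -> 0 <= d x y.
Proof.
move=> d_metric; have [_ [dC dT]] := d_metric.
by have := dT x y x; rewrite [d y x]dC metric_xx //; lra.
Qed.

Definition midpoint_convex (R : realType) (Y : Type) (d : Y -> Y -> R) (p kappa : R) : Prop :=
  forall y z : Y, exists q : Y, forall x : Y,
    d x q `^ p <= (d x y `^ p + d x z `^ p) / 2 - kappa * d y z `^ p.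

Lemma p_uniformly_convex_midpoint (R : realType) (Y : Type) (d : Y -> Y -> R) (p : R) :
  geodesic_space d -> p_uniformly_convex d p ->
  exists2 kappa : R, 0 < kappa & midpoint_convex d p kappa.
Proof.
move=> d_geodesic [c [c_gt0 d_convex]].
exists (c `^ p / 4); first by rewrite divr_gt0 ?powR_gt0.
move=> y z; have [g yzg] := d_geodesic y z; exists (g 2^-1) => x.
have half01 : 0 <= (2^-1 : R) <= 1 by apply/andP; split; lra.
by have := d_convex x y z g yzg 2^-1 half01; lra.
Qed.

Lemma approx_minimizer (R : realType) (Y : Type) (F : Y -> R) (b delta : R) :
  inhabited Y -> (forall y, b <= F y) -> 0 < delta ->
  exists z0, forall z, F z0 <= F z + delta.
Proof.
move=> [y0] F_ge delta_gt0.
have F_inf : has_inf (range F).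
  by split; [exists (F y0), y0 | exists b => _ [y _ <-]].
have [_ [z0 _ <-] lt_z0] := inf_adherent delta_gt0 F_inf.
exists z0 => z; apply: (le_trans (ltW lt_z0)); rewrite lerD2r.
by apply: ge_inf; [exact: F_inf.2 | exists z].
Qed.

Section MetricLimits.
Variables (R : realType) (Y : Type) (d : Y -> Y -> R).
Hypothesis d_metric : is_metric d.

Lemma geometric_steps_cauchy (u : nat -> Y) (A r : R) : 0 <= A -> 0 <= r < 1 ->
  (forall n, d (u n) (u n.+1) <= A * r ^+ n) -> is_cauchy d u.
Proof.
move=> A_ge0 /andP[r_ge0 r_lt1] step; have [_ [dC dT]] := d_metric.
have r1_gt0 : 0 < 1 - r by lra.
have dist_add N i : d (u N) (u (N + i)%N) <= A * r ^+ N * (1 - r ^+ i) / (1 - r).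
  elim: i => [|i IHi]; first by rewrite addn0 metric_xx // subrr mulr0 mul0r.
  have -> : A * r ^+ N * (1 - r ^+ i.+1) / (1 - r)
      = A * r ^+ N * (1 - r ^+ i) / (1 - r) + A * r ^+ (N + i).
    by rewrite exprS exprD; field; rewrite gt_eqF.
  by rewrite (le_trans (dT _ (u (N + i)%N) _)) // lerD // addnS.
have dist_tail N n : (N <= n)%N -> d (u N) (u n) <= A / (1 - r) * r ^+ N.
  move=> /subnKC <-; apply: (le_trans (dist_add _ _)).
  rewrite mulrAC [A / _ * _]mulrAC ler_piMr ?divr_ge0 ?mulr_ge0 ?exprn_ge0 ?(ltW r1_gt0) //.
  by rewrite lerBlDr lerDl exprn_ge0.
move=> eps eps_gt0; have eps2_gt0 : 0 < eps / 2 by rewrite divr_gt0.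
have r_norm : `|r| < 1 by rewrite ger0_norm.
have /cvgr0Pnorm_lt /(_ _ eps2_gt0) [N _ small_N] := cvg_geometric (A / (1 - r)) r_norm.
have lt_N : A / (1 - r) * r ^+ N < eps / 2.
  exact: le_lt_trans (ler_norm _) (small_N N (leqnn N)).
exists N => m n le_m le_n; apply: (le_lt_trans (dT _ (u N) _)); rewrite dC.
by have := dist_tail N m le_m; have := dist_tail N n le_n; move: lt_N; lra.
Qed.

Lemma isometry_fixes_limit (u : nat -> Y) (l : Y) (f : Y -> Y) :
  (forall x y, d (f x) (f y) = d x y) -> converges_to d u l ->
  d (u n) (f (u n)) @[n --> \oo] --> (0 : R) -> f l = l.
Proof.
move=> f_iso u_l /cvgr0Pnorm_lt move_u; have [d_eq0 [dC dT]] := d_metric.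
apply/d_eq0/le_anti; rewrite metric_ge0 // andbT.
apply/ler_addgt0Pr => eps eps_gt0; rewrite add0r.
have eps3_gt0 : 0 < eps / 3 by rewrite divr_gt0.
have [N1 u_near_l] := u_l _ eps3_gt0; have [N2 _ move_small] := move_u _ eps3_gt0.
pose n := maxn N1 N2; have u_l_small := u_near_l n (leq_maxl _ _).
have u_f_small := le_lt_trans (ler_norm _) (move_small n (leq_maxr _ _)).
have := dT (f l) (f (u n)) l; rewrite f_iso [d l (u n)]dC.
by have := dT (f (u n)) (u n) l; rewrite [d (f _) (u n)]dC; move: u_l_small u_f_small; lra.
Qed.

Lemma contraction_orbit (F : Y -> R) (C r : R) :
  complete_metric d -> inhabited Y -> 0 <= C -> 0 <= r < 1 -> (forall y, 0 <= F y) ->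
  (forall y, exists z, F z <= r * F y /\ d y z <= C * F y) ->
  exists (u : nat -> Y) (l : Y), converges_to d u l /\
    forall n, F (u n) <= F (u 0%N) * r ^+ n.
Proof.
move=> d_complete [y0] C_ge0 r01 F_ge0 /choice[f f_contr].
have [r_ge0 r_lt1] := andP r01.
pose u n := iter n f y0.
have F_u n : F (u n) <= F y0 * r ^+ n.
  elim: n => [|n IHn]; first by rewrite expr0 mulr1.
  by apply: (le_trans (f_contr (u n)).1); rewrite exprS mulrCA ler_wpM2l.
have u_cauchy : is_cauchy d u.
  apply: (@geometric_steps_cauchy u (C * F y0) r) => // [|n]; first by rewrite mulr_ge0.
  by rewrite (le_trans (f_contr (u n)).2) // -mulrA ler_wpM2l.
by have [l u_l] := d_complete u u_cauchy; exists u, l.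
Qed.

End MetricLimits.

Lemma iter_avg_dist_le (R : realType) (Y : Type) (d : Y -> Y -> R) (p : R) (I : finType)
    (mu : I -> R) (g : I -> Y -> Y) (m : nat) (r B : R) (y v : Y) :
  is_metric d -> (forall i x y, d (g i x) (g i y) = d x y) ->
  (forall i, 0 <= mu i) -> \sum_i mu i = 1 -> 0 <= p -> 0 <= r -> 0 <= B ->
  (forall i, d y (g i y) <= B) ->
  iter m (avg mu g) (fun u => (r + d y u) `^ p) v <= (r + m%:R * B + d y v) `^ p.
Proof.
move=> d_metric g_iso mu_ge0 mu_sum1 p_ge0 r_ge0 B_ge0 le_B.
have [_ [_ dT]] := d_metric.
elim: m v => [|m IHm] v; first by rewrite mul0r addr0.
rewrite -[leRHS](iter_avg_cst g 1 _ v mu_sum1) iterS ler_sum // => i _.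
rewrite ler_wpM2l // (le_trans (IHm _)) // ler_wpowR2r //.
  by rewrite !addr_ge0 ?mulr_ge0 //; exact: metric_ge0.
have := dT y (g i y) (g i v); rewrite g_iso -natr1.
by have := le_B i; lra.
Qed.

Section IsometricWalk.
Variables (R : realType) (Y : Type) (d : Y -> Y -> R) (p : R).
Variables (I : finType) (mu : I -> R) (g g' : I -> Y -> Y).

(* The mean of d (z, W y) ^ p for the product W of m independent mu-random maps g i. *)
Definition moment (m : nat) (y z : Y) : R := iter m (avg mu g) (fun v => d z v `^ p) y.

Definition displacement (y : Y) : R := moment 1 y y.

(* Along a sequence of N, the moments grow at most by a factor o (sqrt (ln N / ln ln N))
   up to a time of the order of ln N, which may depend on the starting point. *)
Definition slow_growth (a b : R) : Prop :=
  forall (delta : R) (M : nat), 0 < delta -> exists (N : nat) (Lam : R),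
    [/\ (M <= N)%N, 0 <= Lam, Num.sqrt (loglog_ratio N) * (1 + Lam) <= delta &
        forall y, exists m : nat, a * ln N%:R <= m%:R <= b * ln N%:R /\
          moment m y y <= Lam * displacement y].

Hypothesis d_metric : is_metric d.
Hypothesis g_iso : forall i x y, d (g i x) (g i y) = d x y.
Hypothesis g'K : forall i, cancel (g' i) (g i).

Lemma isometry_adjoint (i : I) (y z : Y) : d z (g i y) = d (g' i z) y.
Proof. by rewrite -{1}(g'K i z) g_iso. Qed.

Lemma momentS (m : nat) (y z : Y) :
  moment m.+1 y z = \sum_i mu i * moment m y (g' i z).
Proof.
rewrite /moment iterSr -iter_avg_sum; congr (iter m _ _ y).
by apply/funext => v; apply: eq_bigr => i _; rewrite isometry_adjoint.
Qed.

Hypotheses (p_gt0 : 0 < p) (mu_gt0 : forall i, 0 < mu i) (mu_sum1 : \sum_i mu i = 1).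
Let p_ge0 : 0 <= p := ltW p_gt0.
Let mu_ge0 i : 0 <= mu i := ltW (mu_gt0 i).

Definition sum_inv_weight : R := \sum_i (mu i)^-1.

Lemma sum_inv_weight_ge0 : 0 <= sum_inv_weight.
Proof. by rewrite sumr_ge0 // => i _; rewrite invr_ge0. Qed.

Lemma moment_ge0 (m : nat) (y z : Y) : 0 <= moment m y z.
Proof. by apply: iter_avg_ge0 => // v; exact: powR_ge0. Qed.

Lemma displacement_ge0 (y : Y) : 0 <= displacement y.
Proof. exact: moment_ge0. Qed.

Lemma dist_le_displacement (i : I) (y : Y) :
  d y (g i y) <= (sum_inv_weight * displacement y) `^ p^-1.
Proof.
apply: ler_powR_root => //; first exact: metric_ge0.
apply: (@le_trans _ _ ((mu i)^-1 * displacement y)); last first.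
  rewrite ler_wpM2r ?displacement_ge0 // /sum_inv_weight (bigD1 i) //= lerDl.
  by rewrite sumr_ge0 // => l _; rewrite invr_ge0.
rewrite ler_pdivlMl // /displacement /moment /= /avg (bigD1 i) //=.
by rewrite lerDl sumr_ge0 // => l _; rewrite mulr_ge0 ?powR_ge0.
Qed.

Variable i0 : I.
Hypotheses (g_hold : forall v, g i0 v = v) (mu_hold_lt1 : mu i0 < 1).

(* The walk holds with probability mu i0, so its m-th power is a binomial mixture of powers
   of the walk conditioned to avoid i0. *)
Lemma lazy_momentS (m : nat) (y z : Y) (B eps : R) :
  0 <= eps <= 1 -> 0 <= B -> (forall i, d y (g i y) <= B) ->
  moment m.+1 y z <= (1 + eps) * moment m y z
    + (d y z + m.+1%:R * B) `^ p * expR (- (m.+1%:R * (mu i0 * eps / 4) ^+ 2)).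
Proof.
move=> eps01 B_ge0 le_B; have [_ [dC dT]] := d_metric.
have mixture n : moment n y z = \sum_(i < n.+1) binomial_pmf n (mu i0).~ i *
    iter i (avg (weight_avoiding mu i0) g) (fun v => d z v `^ p) y.
  rewrite -iter_avg_lazy /moment; congr (iter n _ _ y).
  by apply/funext => h; apply/funext => v; rewrite onemK (avg_lazyE (i0 := i0)).
rewrite !mixture -{3}(onemK (mu i0)).
apply: (@binomial_mean_trialS _ (mu i0).~ _ eps _ m
  (fun i => iter i (avg (weight_avoiding mu i0) g) (fun v => d z v `^ p) y)) => //.
  by rewrite onem_ge0 ?(ltW mu_hold_lt1) // onem_le1.
have avoid_ge0 := weight_avoiding_ge0 mu_ge0 mu_hold_lt1.
have dy_ge0 v : 0 <= d y v := metric_ge0 y v d_metric.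
move=> i le_im; rewrite iter_avg_ge0 //= => [|v]; last exact: powR_ge0.
rewrite -[d y z + _]addr0 -(metric_xx y d_metric).
apply: (@le_trans _ _ ((d y z + i%:R * B + d y y) `^ p)).
  apply: le_trans (iter_avg_dist_le i y d_metric g_iso avoid_ge0
    (sum_weight_avoiding mu_sum1 mu_hold_lt1) p_ge0 (dy_ge0 z) B_ge0 le_B).
  by apply: le_iter_avg => // v; rewrite ler_wpowR2r ?metric_ge0 // [d y z]dC dT.
rewrite ler_wpowR2r ?addr_ge0 ?mulr_ge0 // !lerD2r lerD2l ler_wpM2r //.
by rewrite ler_nat.
Qed.

Lemma lazy_moment_growth (m : nat) (y z : Y) (eps : R) :
  0 <= eps <= 1 ->
  negligible_tail p (mu i0) eps m.+1%:R ->
  moment m.+1 y z <= (1 + eps) * moment m y z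
    + eps * (2 `^ p * (d y z `^ p + sum_inv_weight * displacement y)).
Proof.
rewrite /negligible_tail => eps01 tail_le; set Q := sum_inv_weight.
have Q_ge0 : 0 <= Q by exact: sum_inv_weight_ge0.
have QE_ge0 : 0 <= Q * displacement y by rewrite mulr_ge0 // displacement_ge0.
set X := expR _ in tail_le *; have X_ge0 : 0 <= X by exact: expR_ge0.
apply: le_trans (lazy_momentS m z eps01 (powR_ge0 _ _)
  (fun i => dist_le_displacement i y)) _.
rewrite lerD2l -/X -/Q; set B := _ `^ p^-1; have B_ge0 : 0 <= B by exact: powR_ge0.
have -> : Q * displacement y = B `^ p by rewrite powRVK // gt_eqF.
have dyz_ge0 : 0 <= d y z by exact: metric_ge0.
apply: (@le_trans _ _ (m.+1%:R `^ p * X * (2 `^ p * (d y z `^ p + B `^ p)))).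
  by rewrite [leRHS]mulrAC ler_wpM2r // powR_affine_le ?ler1n.
by rewrite ler_wpM2r // mulr_ge0 ?addr_ge0 ?powR_ge0.
Qed.

Variable kappa : R.
Hypotheses (kappa_gt0 : 0 < kappa) (d_convex : midpoint_convex d p kappa).

Lemma moment_midpoint (m : nat) (y z z' : Y) : exists q,
  moment m y q <= (moment m y z + moment m y z') / 2 - kappa * d z z' `^ p.
Proof.
have [_ [dC _]] := d_metric; have [q le_q] := d_convex z z'; exists q.
pose half_sum v : R := 2^-1 * d z v `^ p + 2^-1 * d z' v `^ p.
apply: (@le_trans _ _ (iter m (avg mu g)
    (fun v => 1 * half_sum v + (-1) * (kappa * d z z' `^ p)) y)).
  apply: le_iter_avg => // v; rewrite [d q v]dC (le_trans (le_q v)) // /half_sum.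
  by rewrite [d v z]dC [d v z']dC; lra.
by rewrite !iter_avgD iter_avg_cst // /moment; lra.
Qed.

(* At an approximate minimizer z of the m-th moment, averaging the convexity inequality over
   the translates of z bounds the displacement of z by the growth of its moment. *)
Lemma approx_barycenter (m : nat) (y : Y) (delta : R) : 0 < delta ->
  exists z, [/\ moment m y z <= moment m y y + delta,
    2 * kappa * d y z `^ p <= moment m y y + 2 * delta &
    2 * kappa * displacement z <= moment m.+1 y z - moment m y z + 2 * delta].
Proof.
move=> delta_gt0.
have [z min_z] := approx_minimizer (inhabits y) (moment_ge0 m y) delta_gt0.
have convex_at z' : 2 * kappa * d z' z `^ p <= moment m y z' - moment m y z + 2 * delta.
  by have [q le_q] := moment_midpoint m y z' z; have := min_z q; lra.
exists z; split; first exact: min_z.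
  by have := convex_at y; have := moment_ge0 m y z; lra.
have -> : moment m.+1 y z - moment m y z + 2 * delta
    = \sum_i mu i * (moment m y (g' i z) - moment m y z + 2 * delta).
  under eq_bigr do rewrite -addrA mulrDr.
  by rewrite big_split /= -momentS -mulr_suml mu_sum1 mul1r addrA.
rewrite /displacement momentS mulr_sumr ler_sum // => i _.
by rewrite mulrCA ler_wpM2l //; exact: convex_at.
Qed.

Definition contraction_const : R := (3 + 2 `^ p * (kappa^-1 + sum_inv_weight)) / (2 * kappa).
Local Notation C := contraction_const.

Lemma contraction_const_gt0 : 0 < C.
Proof.
rewrite divr_gt0 ?mulr_gt0 // ltr_wpDr // mulr_ge0 ?powR_ge0 // addr_ge0 //.
  by rewrite invr_ge0 ltW.
exact: sum_inv_weight_ge0.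
Qed.

Lemma displacement_contraction (m : nat) (y : Y) (eps Lam : R) :
  0 < eps <= 1 -> 0 <= Lam ->
  negligible_tail p (mu i0) eps m.+1%:R ->
  moment m y y <= Lam * displacement y ->
  exists z, displacement z <= C * eps * ((1 + Lam) * displacement y) /\
    d y z `^ p <= kappa^-1 * ((1 + Lam) * displacement y).
Proof.
move=> /andP[eps_gt0 eps_le1] Lam_ge0 tail_le growth_y.
have : 0 <= displacement y by exact: displacement_ge0.
set E := displacement y in growth_y *; set W := (1 + Lam) * E.
rewrite le_eqVlt => /predU1P[E0|E_gt0].
  exists y; rewrite -/E /W -E0 !mulr0; split=> //.
  by rewrite metric_xx // powR0 // gt_eqF.
have [z [moment_z dist_z disp_z]] := approx_barycenter m y (mulr_gt0 eps_gt0 E_gt0).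
have epsE_le : eps * E <= E by rewrite ler_piMl // ltW.
have LamE_ge0 : 0 <= Lam * E by rewrite mulr_ge0 // ltW.
have moment_le : moment m y z <= W by move: moment_z growth_y epsE_le; rewrite /W; lra.
have dist_le : d y z `^ p <= kappa^-1 * W.
  by rewrite ler_pdivlMl //; move: dist_z growth_y epsE_le LamE_ge0; rewrite /W; lra.
exists z; split=> //.
have eps01 : 0 <= eps <= 1 by rewrite ltW.
have growth_z := lazy_moment_growth y z eps01 tail_le.
set Q := sum_inv_weight in growth_z; rewrite -/E in growth_z.
have Q_ge0 : 0 <= Q by exact: sum_inv_weight_ge0.
rewrite -(ler_pM2l (mulr_gt0 (ltr0n R 2) kappa_gt0)).
have -> : 2 * kappa * (C * eps * W) = eps * ((3 + 2 `^ p * (kappa^-1 + Q)) * W).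
  by rewrite /C -/Q; field; rewrite gt_eqF.
apply: (@le_trans _ _ (eps * (moment m y z + 2 `^ p * (d y z `^ p + Q * E) + 2 * E))).
  by move: disp_z growth_z; lra.
rewrite ler_wpM2l ?(ltW eps_gt0) //.
have E_le : E <= W by rewrite /W; move: LamE_ge0; lra.
have tail_z : 2 `^ p * (d y z `^ p + Q * E) <= 2 `^ p * (kappa^-1 * W + Q * W).
  by rewrite ler_wpM2l ?powR_ge0 // lerD // ler_wpM2l.
by move: moment_le tail_z E_le; lra.
Qed.

Local Notation E := displacement.
Variables a b : R.
Hypotheses (a_gt0 : 0 < a) (b_gt0 : 0 < b) (growth : slow_growth a b).

Lemma slow_growth_contraction (eta : R) : 0 < eta ->
  exists2 D : R, 0 <= D & forall y, exists z, E z <= eta * E y /\ d y z `^ p <= D * E y.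
Proof.
move=> eta_gt0.
have [A A_gt0 tail] := near_negligible_tail p_gt0 a_gt0 b_gt0 (mu_gt0 i0).
have [M _ tailM] := filterI (@loglog_ratio_gt0 R) tail.
have C_gt0 := contraction_const_gt0.
have delta_gt0 : 0 < Num.min 1 (eta / C) / A by rewrite divr_gt0 // lt_min ltr01 divr_gt0.
have [N [Lam [/tailM[ratio_gt0 tailN] Lam_ge0 rate growthN]]] := growth M delta_gt0.
exists (kappa^-1 * (1 + Lam)); first by rewrite mulr_ge0 ?invr_ge0 ?addr_ge0 // ltW.
move=> y; have [m [/tailN tailm growth_y]] := growthN y.
set eps := A * _ in tailm.
have eps_gt0 : 0 < eps by rewrite mulr_gt0 // sqrtr_gt0.
have : eps * (1 + Lam) <= Num.min 1 (eta / C).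
  by rewrite -mulrA mulrC -ler_pdivlMr.
rewrite le_min => /andP[eps_le1 eps_le].
have eps01 : 0 < eps <= 1.
  by rewrite eps_gt0 (le_trans _ eps_le1) // ler_peMr ?(ltW eps_gt0) // lerDl.
have [z [disp_z dist_z]] := displacement_contraction eps01 Lam_ge0 tailm growth_y.
exists z; split; last by rewrite -mulrA.
apply: (le_trans disp_z); rewrite mulrA ler_wpM2r ?displacement_ge0 //.
by rewrite -mulrA mulrC -ler_pdivlMr.
Qed.

Lemma slow_growth_fixed_point : complete_metric d -> inhabited Y ->
  exists l, forall i, g i l = l.
Proof.
move=> d_complete Y_inh.
have E_ge0 y : 0 <= E y by exact: displacement_ge0.
have p_neq0 : p != 0 by rewrite gt_eqF.
have half_ge0 : 0 <= 2^-1 :> R by rewrite invr_ge0.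
have [|D D_ge0 contr] := @slow_growth_contraction (2^-1 `^ p); first by rewrite powR_gt0.
pose F y := E y `^ p^-1.
have [||||u [l [u_l F_u]]] :=
    @contraction_orbit R Y d d_metric F (D `^ p^-1) 2^-1 d_complete Y_inh.
- exact: powR_ge0.
- by apply/andP; split; lra.
- by move=> y; exact: powR_ge0.
- move=> y; have [z [E_z dist_z]] := contr y; exists z; split.
    by rewrite -[2^-1](powRK p_neq0) // -powRM ?powR_ge0 // ler_wpowR2r // invr_ge0 ltW.
  by rewrite -powRM //; apply: ler_powR_root => //; exact: metric_ge0.
exists l => i; apply: (isometry_fixes_limit d_metric _ u_l) => //.
set Q := sum_inv_weight; have Q_ge0 : 0 <= Q by exact: sum_inv_weight_ge0.
have half_norm : `|2^-1 : R| < 1 by rewrite ger0_norm //; lra.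
apply: squeeze_cvgr (cvg_cst 0) (cvg_geometric (Q `^ p^-1 * F (u 0%N)) half_norm).
apply: nearW => n; rewrite metric_ge0 //= (le_trans (dist_le_displacement i (u n))) //.
by rewrite -/Q powRM // -mulrA ler_wpM2l ?powR_ge0 //; exact: F_u.
Qed.

End IsometricWalk.

Section Midpoints.
Variables (R : realType) (Y : Type) (d : Y -> Y -> R).
Hypothesis d_metric : is_metric d.

Definition is_midpoint (y z x : Y) : Prop := d y x = d y z / 2 /\ d z x = d y z / 2.

Lemma geodesic_midpoint (y z : Y) : geodesic_space d -> exists x, is_midpoint y z x.
Proof.
move=> d_geodesic; have [g [g0 [g1 g_speed]]] := d_geodesic y z; exists (g 2^-1).
have half01 : 0 <= (2^-1 : R) <= 1 by apply/andP; split; lra.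
split.
  rewrite -{1}g0 g_speed ?lexx ?ler01 //.
  by rewrite sub0r normrN ger0_norm ?invr_ge0 // mulrC.
rewrite -{1}g1 g_speed ?lexx ?ler01 //.
by rewrite ger0_norm; lra.
Qed.

Section Uniqueness.
Variables (p kappa : R).
Hypotheses (p_gt0 : 0 < p) (kappa_gt0 : 0 < kappa) (d_convex : midpoint_convex d p kappa).

Lemma midpoint_unique (y z x x' : Y) : is_midpoint y z x -> is_midpoint y z x' -> x = x'.
Proof.
move=> [yx zx] [yx' zx']; have [d_eq0 [dC dT]] := d_metric; apply/d_eq0.
apply/le_anti; rewrite metric_ge0 // andbT leNgt; apply/negP => xx'_gt0.
have [q le_q] := d_convex x x'.
have closer v : d v x = d y z / 2 -> d v x' = d y z / 2 -> d v q < d y z / 2.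
  move=> vx vx'; rewrite ltNge; apply/negP => half_le.
  have := le_q v; rewrite vx vx'.
  have := ler_wpowR2r (ltW p_gt0) (divr_ge0 (metric_ge0 y z d_metric) (ler0n _ 2)) half_le.
  by have := mulr_gt0 kappa_gt0 (powR_gt0 p xx'_gt0); lra.
have := dT y q z; rewrite [d q z]dC.
by have := closer y yx yx'; have := closer z zx zx'; lra.
Qed.

Lemma swap_fixes_midpoint (y z x : Y) (f : Y -> Y) :
  (forall u v, d (f u) (f v) = d u v) -> f y = z -> f z = y -> is_midpoint y z x -> f x = x.
Proof.
move=> f_iso fy fz [yx zx]; apply: (@midpoint_unique y z) => //; split.
  by rewrite -{1}fz f_iso.
by rewrite -{1}fy f_iso.
Qed.

End Uniqueness.
End Midpoints.

Section FreeActions.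
Variables (Y : Type) (k : nat) (rho : gen k -> Y -> Y).

Lemma ginvK : involutive (@ginv k).
Proof. by case=> i b; rewrite /ginv /= negbK. Qed.

Lemma act_word_cat (v w : seq (gen k)) (y : Y) :
  act_word rho (v ++ w) y = act_word rho v (act_word rho w y).
Proof. by rewrite /act_word foldr_cat. Qed.

Variables (R : realType) (d : Y -> Y -> R).
Hypothesis rho_iso : isometric_free_action d rho.

Lemma act_word_isometry (w : seq (gen k)) (x y : Y) :
  d (act_word rho w x) (act_word rho w y) = d x y.
Proof. by elim: w => [//|s w IHw] /=; rewrite rho_iso.1. Qed.

Lemma rho_ginvK (s : gen k) : cancel (rho (ginv s)) (rho s).
Proof. by move=> y; rewrite -{1}(ginvK s) rho_iso.2. Qed.

Lemma act_word_invK (w : seq (gen k)) : cancel (act_word rho (word_inv w)) (act_word rho w).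
Proof.
elim: w => [//|s w IHw] y.
by rewrite /word_inv map_cons rev_cons -cats1 act_word_cat /= IHw rho_ginvK.
Qed.

Hypothesis k_gt0 : (0 < k)%N.

Lemma trivial_even_word (n : nat) :
  exists2 w : seq (gen k), size w = n.*2 & act_word rho w =1 id.
Proof.
pose s : gen k := (Ordinal k_gt0, false).
elim: n => [|n [w size_w w_id]]; first by exists [::].
exists (s :: ginv s :: w); first by rewrite /= size_w doubleS.
by move=> y /=; rewrite w_id rho_ginvK.
Qed.

Lemma trivial_tuple_word (j : nat) : ~~ odd j ->
  exists w : j.-tuple (gen k), act_word rho w =1 id.
Proof.
move=> j_even; have [w size_w w_id] := trivial_even_word j./2.
have {}size_w : size w == j by rewrite size_w even_halfK.
by exists (Tuple size_w).
Qed.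

Lemma fixed_tuples_fixed_pairs (j : nat) (l : Y) : (0 < j)%N -> ~~ odd j ->
  (forall w : j.-tuple (gen k), act_word rho w l = l) -> forall s s', rho s (rho s' l) = l.
Proof.
move=> j_gt0 j_even fix_l s s'.
have [w size_w w_id] := trivial_even_word j./2.-1.
have size_ssw : size [:: s, s' & w] == j.
  rewrite /= size_w -doubleS prednK ?even_halfK //.
  by rewrite half_gt0; case: j j_gt0 j_even {fix_l size_w} => [|[]].
by have := fix_l (Tuple size_ssw); rewrite /= w_id.
Qed.

(* All generators exchange l with one and the same point z, hence fix the midpoint. *)
Lemma fixed_pairs_fixed_point (p kappa : R) (l : Y) : 0 < p -> 0 < kappa ->
  is_metric d -> geodesic_space d -> midpoint_convex d p kappa ->
  (forall s s', rho s (rho s' l) = l) ->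
  exists y : Y, forall w : seq (gen k), act_word rho w y = y.
Proof.
move=> p_gt0 kappa_gt0 d_metric d_geodesic d_convex pairs_l.
pose z := rho (Ordinal k_gt0, false) l.
have rho_l s : rho s l = z by rewrite -{1}(pairs_l (ginv s) (Ordinal k_gt0, false)) rho_ginvK.
have [y mid_y] := geodesic_midpoint l z d_geodesic.
exists y; elim=> [//|s w IHw] /=; rewrite IHw.
exact: (swap_fixes_midpoint d_metric p_gt0 kappa_gt0 d_convex (rho_iso.1 s)
  (rho_l s) (pairs_l s _) mid_y).
Qed.

End FreeActions.

Lemma big_tuple0 (R : Type) (idx : R) (op : Monoid.law idx) (T : finType)
    (F : 0.-tuple T -> R) : \big[op/idx]_(w : 0.-tuple T) F w = F [tuple].
Proof. by rewrite (big_pred1 [tuple]) // => w; apply/esym/eqP; exact: tuple0. Qed.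

Lemma big_tupleS (R : Type) (idx : R) (op : Monoid.com_law idx) (T : finType) (n : nat)
    (F : n.+1.-tuple T -> R) :
  \big[op/idx]_(w : n.+1.-tuple T) F w
    = \big[op/idx]_(a : T) \big[op/idx]_(w : n.-tuple T) F [tuple of a :: w].
Proof.
rewrite pair_big /=.
rewrite (reindex (fun x : T * n.-tuple T => [tuple of x.1 :: x.2])) //=.
exists (fun w : n.+1.-tuple T => (thead w, [tuple of behead w])) => [[a w]|w] _ /=.
  by congr pair; apply: val_inj.
by rewrite [RHS](tuple_eta w).
Qed.

Section WordWalk.
Variables (R : realType) (Y : Type) (k : nat) (rho : gen k -> Y -> Y).
Hypothesis k_gt0 : (0 < k)%N.

Definition word_weight (n : nat) (_ : n.-tuple (gen k)) : R := (2 * k)%:R ^- n.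

Definition word_move (n : nat) (w : n.-tuple (gen k)) : Y -> Y := act_word rho w.

Lemma avg_word_iter (n : nat) :
  avg (@word_weight n) (@word_move n) = iter n (avg (fun=> (2 * k)%:R^-1) rho).
Proof.
apply/funext => h; apply/funext => y; elim: n h => [|n IHn] h.
  by rewrite /avg big_tuple0 /word_weight expr0 invr1 mul1r.
rewrite iterSr -IHn /avg big_tupleS exchange_big /=.
apply: eq_bigr => w _; rewrite mulr_sumr; apply: eq_bigr => s _.
by rewrite /word_weight exprS invfM mulrA [_ ^-1 * _]mulrC.
Qed.

Lemma word_weight_gt0 (n : nat) (w : n.-tuple (gen k)) : 0 < word_weight w.
Proof. by rewrite invr_gt0 exprn_gt0 // ltr0n muln_gt0. Qed.

Lemma word_weight_sum1 (n : nat) : \sum_(w : n.-tuple (gen k)) word_weight w = 1.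
Proof.
rewrite /word_weight sumr_const card_tuple card_prod card_ord card_bool -[LHS]mulr_natr.
by rewrite natrX mulnC mulVf // gt_eqF // exprn_gt0 // ltr0n muln_gt0 k_gt0.
Qed.

Lemma word_weight_lt1 (n : nat) (w : n.-tuple (gen k)) : (0 < n)%N -> word_weight w < 1.
Proof.
move=> n_gt0; rewrite invf_lt1 ?exprn_gt0 ?ltr0n ?muln_gt0 //.
by rewrite exprn_egt1 -?lt0n // ltr1n (leq_trans _ (leq_pmulr 2 k_gt0)).
Qed.

Lemma moment_word_energy (p : R) (d : Y -> Y -> R) (j m : nat) (y : Y) :
  moment d p (@word_weight j) (@word_move j) m y y = 2 * energy p d rho (j * m) y.
Proof.
rewrite /moment avg_word_iter -iterM mulnC -avg_word_iter.
by rewrite /energy mulrA mulfV // mul1r.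
Qed.

End WordWalk.

Section PoincareModulus.
Variables (R : realType) (p sigma : R) (Y : Type) (d : Y -> Y -> R).
Local Notation modulus := (poincare_modulus_N p sigma d).

Lemma poincare_modulus_N_ge0 (N : nat) : (0 <= modulus N)%E.
Proof.
pose Z := poincare_modulus p sigma
  (fun a b : {y : Y | (set0 : set Y) y} => d (sval a) (sval b)).
apply: (@le_trans _ _ Z); last by apply: ereal_sup_ubound; exists set0 => //; exists [::].
by apply: le_ereal_inf_tmp => _ [L [L_ge0 _] <-]; rewrite lee_fin.
Qed.

Lemma poincare_modulus_N_le (L : R) (N : nat) : 0 <= L -> poincare_ineq p sigma d L ->
  (modulus N <= L%:E)%E.
Proof.
move=> L_ge0 poincare_L; apply: ge_ereal_sup => _ [A _ <-].
apply: ge_ereal_inf; exists L%:E => //; exists L => //; split=> // V mu nu rev gap f.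
exact: (poincare_L V mu nu rev gap (fun v => sval (f v))).
Qed.

Hypothesis p_gt0 : 0 < p.
Local Notation rate N := (loglog_ratio N `^ (1 / (2 * p))).

Lemma poincare_modulus_lt_pinfty_cvg0 : (poincare_modulus p sigma d < +oo)%E ->
  ((rate N)%:E * modulus N)%E @[N --> \oo] --> (0 : \bar R).
Proof.
move=> /ereal_inf_lt[_ [L [L_ge0 poincare_L] <-] _].
have rate_cvg0 : (rate N * L)%:E @[N --> \oo] --> (0 : \bar R).
  apply: cvg_EFin; first by apply: nearW.
  rewrite -(mul0r L); apply: cvgM (cvg_cst L).
  by apply: loglog_ratio_powR_cvg0; rewrite divr_gt0 // mulr_gt0.
apply: squeeze_cvge (cvg_cst (0 : \bar R)) rate_cvg0.
apply: nearW => N; rewrite mule_ge0 ?lee_fin ?powR_ge0 ?poincare_modulus_N_ge0 //=.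
by rewrite EFinM lee_wpmul2l ?lee_fin ?powR_ge0 ?poincare_modulus_N_le.
Qed.

Lemma near_poincare_modulus_rate_le (delta : R) :
  ((rate N)%:E * modulus N)%E @[N --> \oo] --> (0 : \bar R) -> 0 < delta ->
  \forall N \near \oo, exists L : R, [/\ 0 <= L, (modulus N <= L%:E)%E &
    Num.sqrt (loglog_ratio N) * (1 + L `^ p) <= delta].
Proof.
move=> /fine_cvgP[rate_fin /cvgr0Pnorm_lt rate_cvg0] delta_gt0.
have half_gt0 : 0 < delta / 2 by rewrite divr_gt0.
have root_gt0 : 0 < (delta / 2) `^ p^-1 by rewrite powR_gt0.
have sqrt_cvg0 : loglog_ratio N `^ 2^-1 @[N --> \oo] --> (0 : R).
  by apply: loglog_ratio_powR_cvg0; rewrite invr_gt0.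
near=> N.
have u_gt0 : 0 < loglog_ratio N :> R by near: N; exact: loglog_ratio_gt0.
have u_small : loglog_ratio N `^ 2^-1 <= delta / 2.
  apply: (le_trans (ler_norm _)); apply: ltW; near: N.
  by move/cvgr0Pnorm_lt: sqrt_cvg0; apply.
have fin_N : ((rate N)%:E * modulus N)%E \is a fin_num by near: N; exact: rate_fin.
have : `|fine ((rate N)%:E * modulus N)%E| < (delta / 2) `^ p^-1.
  by near: N; exact: rate_cvg0.
have rate_gt0 : 0 < rate N by rewrite powR_gt0.
have := poincare_modulus_N_ge0 N; move: fin_N.
case: (modulus N) => [L _|+ _|//] /=; last by rewrite gt0_muley ?lte_fin.
rewrite lee_fin => L_ge0 /ltW rateL_le; exists L; split=> //.
have rate_le : rate N * L <= (delta / 2) `^ p^-1 := le_trans (ler_norm _) rateL_le.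
have := ler_wpowR2r (ltW p_gt0) (mulr_ge0 (ltW rate_gt0) L_ge0) rate_le.
rewrite powRVK ?gt_eqF ?(ltW half_gt0) // powRM ?(ltW rate_gt0) // -powRrM.
have -> : 1 / (2 * p) * p = 2^-1 by field; rewrite gt_eqF.
by rewrite -powR12_sqrt ?(ltW u_gt0) // mulrDr mulr1; lra.
Unshelve. all: by end_near. Qed.

End PoincareModulus.

Lemma property_P_slow_growth (R : realType) (T : nat -> finType) (e : forall i, rel (T i))
    (p sigma : R) (k j : nat) (alpha : forall i, T i -> T i -> j.-tuple (gen k))
    (Y : Type) (d : Y -> Y -> R) (rho : gen k -> Y -> Y) :
  0 < p -> is_metric d -> property_P p sigma e alpha -> alpha_action d e alpha rho ->
  ((loglog_ratio N `^ (1 / (2 * p)))%:E * poincare_modulus_N p sigma d N)%E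
    @[N --> \oo] --> (0 : \bar R) ->
  exists a b : R, [/\ 0 < a, 0 < b &
    slow_growth d p (@word_weight R k j) (@word_move Y k rho j) a b].
Proof.
move=> p_gt0 d_metric [a [b [K [a_gt0 [b_gt0 [K_gt0 energy_growth]]]]]] act rate_cvg0.
exists a, b; split=> // delta M delta_gt0.
have K1_gt0 : 0 < 1 + K by rewrite addr_gt0.
have [M' _ small_rate] :=
  near_poincare_modulus_rate_le p_gt0 rate_cvg0 (divr_gt0 delta_gt0 K1_gt0).
have [i []] := energy_growth Y d d_metric rho act (maxn M M').
rewrite geq_max => /andP[M_le /small_rate[L [L_ge0 modulus_le rate_le]]] energy_le.
have Lp_ge0 : 0 <= L `^ p by exact: powR_ge0.
exists #|T i|, (K * L `^ p); split=> // [||y].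
- by rewrite mulr_ge0 // ltW.
- move: rate_le; rewrite ler_pdivlMr // -mulrA; apply: le_trans.
  rewrite ler_wpM2l ?sqrtr_ge0 //.
  by have := mulr_ge0 (ltW K_gt0) Lp_ge0; lra.
have [m [m_range energy_m]] := energy_le y; exists m; split=> //.
rewrite /displacement !moment_word_energy muln1 [leRHS]mulrCA ler_pM2l // -lee_fin.
have energy_ge0 : 0 <= energy p d rho j y.
  by rewrite mulr_ge0 // sumr_ge0 // => w _; rewrite mulr_ge0 ?powR_ge0 // invr_ge0 exprn_ge0.
apply: (le_trans energy_m); rewrite !EFinM lee_wpmul2r ?lee_fin //.
rewrite lee_wpmul2l ?lee_fin ?(ltW K_gt0) // -poweR_EFin gt0_ler_poweR ?(ltW p_gt0) //.
  by rewrite in_itv /= poincare_modulus_N_ge0 leey.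
by rewrite in_itv /= lee_fin L_ge0 leey.
Qed.

Theorem theorem7p6 (R : realType)
  (T : nat -> finType) (e : forall i, rel (T i)) (dg : nat) (cg sigma p : R)
  (k j : nat) (alpha : forall i, T i -> T i -> j.-tuple (gen k))
  (Y : Type) (dY : Y -> Y -> R) :
  graph_family e dg cg sigma -> 0 < cg -> 0 < sigma -> 2 <= p ->
  (0 < k)%N -> (0 < j)%N -> ~~ odd j ->
  is_labeling e alpha -> property_P p sigma e alpha ->
  is_metric dY -> inhabited Y -> complete_metric dY -> geodesic_space dY ->
  p_uniformly_convex dY p ->
  ((poincare_modulus p sigma dY < +oo)%E \/
   (fun N : nat => ((ln (ln N%:R) / ln N%:R) `^ (1 / (2 * p)))%:E
                   * poincare_modulus_N p sigma dY N)%E @ \oo --> (0 : \bar R)) ->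
  forall rho : gen k -> Y -> Y, alpha_action dY e alpha rho ->
  exists y : Y, forall w : seq (gen k), act_word rho w y = y.
Proof.
move=> _ _ _ p_ge2 k_gt0 j_gt0 j_even _ PP Y_metric Y_inh Y_complete Y_geodesic Y_convex.
move=> modulus_small rho act; have rho_iso := act.1.
have p_gt0 : 0 < p by lra.
have [kappa kappa_gt0 Y_midconvex] := p_uniformly_convex_midpoint Y_geodesic Y_convex.
have [|a [b [a_gt0 b_gt0 growth]]] := property_P_slow_growth p_gt0 Y_metric PP act.
  by case: modulus_small => [/poincare_modulus_lt_pinfty_cvg0|//]; apply.
have [w0 w0_id] := trivial_tuple_word rho_iso k_gt0 j_even.
have [l fix_l] : exists l, forall w : j.-tuple (gen k), word_move rho w l = l.
  apply: (slow_growth_fixed_point (i0 := w0) _ _ _ _ _ _ _ _ kappa_gt0 Y_midconvex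
    a_gt0 b_gt0 growth Y_complete Y_inh) => //.
  - by move=> w; exact: act_word_isometry.
  - by move=> w; exact: act_word_invK rho_iso w.
  - by move=> w; exact: word_weight_gt0.
  - exact: word_weight_sum1.
  - exact: word_weight_lt1.
have pairs_l := fixed_tuples_fixed_pairs rho_iso k_gt0 j_gt0 j_even fix_l.
exact: (fixed_pairs_fixed_point rho_iso k_gt0 p_gt0 kappa_gt0 Y_metric Y_geodesic
  Y_midconvex pairs_l).
Qed.
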